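(* Let $\mathcal C\subset\mathbb F[z]^n$ be a convolutional code with column distances $d_j^c=d_j^c(\mathcal C)$, $j\in\mathbb N_0$. Assume that a codeword $v(z)=\sum_{0\le i\le s}v_iz^i\in\mathcal C$ is sent over the erasure channel and that $\hat v(z)=\sum_{0\le i\le s}\hat v_iz^i$ is received, where the number of erased components of $\hat v_i$ is denoted by $\epsilon_i$ (with $\epsilon_i=0$ for $i>s$). If for each $0\le i\le s$ there exists $j\in\mathbb N_0$ such that $$\epsilon_i+\cdots+\epsilon_{i+j}\le d_j^c-1,$$ then all erasures can be recovered, i.e. $v(z)$ is determined by the non-erased components of $\hat v(z)$: it is the only element of $\mathcal C$ of degree at most $s$ that agrees with $\hat v(z)$ in all non-erased components.
   Context: $\mathbb F$ is a finite field. An $(n,k)$ convolutional code $\mathcal C$ is an $\mathbb F[z]$-submodule of $\mathbb F[z]^n$ of rank $k$. For $v\in\mathbb F^n$, the Hamming weight $wt(v)$ is the number of nonzero components of $v$. For $v(z)=\sum_t v_tz^t\in\mathbb F[z]^n$ (with $v_t=0$ for $t>\deg v$) and $j\in\mathbb N_0$, the $j$-th column distance of $\mathcal C$ is $d_j^c(\mathcal C)=\min\{\sum_{t=0}^{j}wt(v_t) : v(z)\in\mathcal C,\ v_0\ne 0\}$. Erasure channel: each component of each $\hat v_i$ is either equal to the corresponding component of the sent vector $v_i$ or is marked as erased, and the receiver knows which components are erased.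
   Formalization: The code is additionally assumed delay-free (some generator matrix G(z) has G(0) of full row rank); without this the claim fails, e.g. for the code generated by (1,1,1) and z(1,0,0). *)

(* Defs.v *)
From HB Require Import structures.
From mathcomp Require Import all_boot all_order all_algebra.

Set Implicit Arguments.
Unset Strict Implicit.
Unset Printing Implicit Defensive.

Import GRing.Theory.
Local Open Scope ring_scope.

Section Codes.

Variables (F : finFieldType) (n : nat).

Implicit Types (C : {pred 'rV[{poly F}]_n}) (v : 'rV[{poly F}]_n).

Definition rows_independent m (B : 'M[{poly F}]_(m, n)) : Prop :=
  forall u : 'rV[{poly F}]_m, u *m B = 0 -> u = 0.

(* k is the maximal number of F[z]-linearly independent elements of C. *)
Definition has_rank C (k : nat) : Prop :=
  (exists2 B : 'M[{poly F}]_(k, n),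
      forall i, row i B \in C & rows_independent B) /\
  (forall B : 'M[{poly F}]_(k.+1, n),
      (forall i, row i B \in C) -> ~ rows_independent B).

Definition convolutional_code C (k : nat) : Prop :=
  submod_closed C /\ has_rank C k.

Definition generator_matrix C k (G : 'M[{poly F}]_(k, n)) : Prop :=
  rows_independent G /\
  (forall v, v \in C <-> exists u : 'rV[{poly F}]_k, v = u *m G).

(* G(0) has full row rank for some generator matrix G, equivalently for all of
   them since two generator matrices differ by a unimodular factor.  Without
   this, a codeword z^i w(z) with w_0 != 0 need not come from a codeword w(z),
   and column distances, which only see codewords with v_0 != 0, say nothing
   about it. *)
Definition delay_free C (k : nat) : Prop :=
  exists2 G : 'M[{poly F}]_(k, n),
    generator_matrix C G & row_free (map_mx (horner_eval 0) G).

Definition coef_vec v (t : nat) : 'rV[F]_n := map_mx (coefp t) v.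

Definition wt (x : 'rV[F]_n) : nat := #|[set l | x 0 l != 0]|.

Definition truncated_wt v (j : nat) : nat :=
  (\sum_(0 <= t < j.+1) wt (coef_vec v t))%N.

(* d is the minimum of truncated_wt v j over the v in C with v_0 != 0. *)
Definition is_column_distance C (j d : nat) : Prop :=
  (exists v, [/\ v \in C, coef_vec v 0 != 0 & truncated_wt v j = d]) /\
  (forall v, v \in C -> coef_vec v 0 != 0 -> (d <= truncated_wt v j)%N).

Definition deg_at_most v (s : nat) : Prop :=
  forall l, (size (v ord0 l) <= s.+1)%N.

(* A received word is a sequence of vectors over option F, None standing for
   an erasure; only its terms of index at most s are meaningful. *)
Definition agrees (s : nat) (vhat : nat -> 'rV[option F]_n) v : Prop :=
  forall i l, (i <= s)%N ->
    vhat i 0 l = None \/ vhat i 0 l = Some (coef_vec v i 0 l).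

Definition erasures (s : nat) (vhat : nat -> 'rV[option F]_n) (i : nat) : nat :=
  if (i <= s)%N then #|[set l | vhat i 0 l == None]| else 0%N.

End Codes.

(* Main.v *)
(** The difference of two solutions is a codeword [e] supported on the erased
    positions.  If [e <> 0] has its first nonzero coefficient at time [i], delay
    freeness gives [e = z^i e'] with [e'] a codeword and [e'_0 <> 0], so for
    every [j] the window [i, ..., i + j] contains at least [d_j] erasures. *)
Require Import Defs.
From HB Require Import structures.
From mathcomp Require Import all_boot all_order all_algebra.

Set Implicit Arguments.
Unset Strict Implicit.
Unset Printing Implicit Defensive.

Import GRing.Theory.
Local Open Scope ring_scope.

Section ErasureDecoding.

Variable F : finFieldType.

Lemma coef_vecE n (v : 'rV[{poly F}]_n) t l : coef_vec v t 0 l = (v 0 l)`_t.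
Proof. by rewrite mxE. Qed.

Lemma horner_eval0_coef_vec n (v : 'rV[{poly F}]_n) :
  map_mx (horner_eval 0) v = coef_vec v 0.
Proof. by apply/rowP => l; rewrite !mxE /horner_eval horner_coef0. Qed.

Variable n : nat.
Implicit Types (C : {pred 'rV[{poly F}]_n}) (v w : 'rV[{poly F}]_n).

Lemma coef_vec_scaleXn v i t : coef_vec ('X^i *: v) (i + t) = coef_vec v t.
Proof.
by apply/rowP => l; rewrite !coef_vecE mxE coefXnM ltnNge leq_addr addKn.
Qed.

Lemma coef_vec_eq0P v : (forall t, coef_vec v t = 0) -> v = 0.
Proof.
move=> v0; apply/rowP => l; apply/polyP => t.
by rewrite mxE coef0 -coef_vecE v0 mxE.
Qed.

Lemma wt_gt0 (x : 'rV[F]_n) : x != 0 -> (0 < wt x)%N.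
Proof. by case/rV0Pn => l xl; apply/card_gt0P; exists l; rewrite inE. Qed.

Lemma truncated_wt_gt0 v j : coef_vec v 0 != 0 -> (0 < truncated_wt v j)%N.
Proof. by move=> v0; rewrite /truncated_wt big_nat_recl // ltn_addr ?wt_gt0. Qed.

(** One factor ['X] is removed at a time: if [w = u *m G] and [w] vanishes at 0, then u(0) G(0) = 0,
    and the full row rank of G(0) forces u(0) = 0. *)
Lemma delay_free_scaleXn C k v i : delay_free C k -> v \in C ->
    (forall t, (t < i)%N -> coef_vec v t = 0) ->
  exists2 w, w \in C & v = 'X^i *: w.
Proof.
case=> G [_ genG] freeG vC; elim: i => [|i IHi] v_lt.
  by exists v; rewrite // expr0 scale1r.
have [|w wC def_v] := IHi; first by move=> t /ltnW; exact: v_lt.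
have w0 : coef_vec w 0 = 0.
  by rewrite -(coef_vec_scaleXn w i) -def_v addn0 v_lt.
have [u def_w] := (genG w).1 wC.
have u0 : coef_vec u 0 = 0.
  apply/eqP; rewrite -(mulmx_free_eq0 _ freeG) -horner_eval0_coef_vec.
  by rewrite -map_mxM -def_w horner_eval0_coef_vec w0.
(* [drop_poly 1] discards the constant term and shifts down; as that term is zero, this is exact
   division by ['X]. *)
pose u' := map_mx (drop_poly 1) u.
have def_u : u = 'X *: u'.
  apply/rowP => l; rewrite !mxE; apply/polyP => -[|t].
    by rewrite coefXM /= -coef_vecE u0 mxE.
  by rewrite coefXM coef_drop_poly addn1.
exists (u' *m G); first by apply/genG; exists u'.
by rewrite def_v def_w def_u -scalemxAl scalerA exprSr.
Qed.

(** Where a symbol was received, both words equal it and their difference vanishes; past [s] both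
    have only zero coefficients. *)
Lemma wt_coef_vec_sub_erasures s vhat v w t :
    deg_at_most v s -> deg_at_most w s ->
    agrees s vhat v -> agrees s vhat w ->
  (wt (coef_vec (v - w) t) <= erasures s vhat t)%N.
Proof.
move=> vs ws vagr wagr; rewrite /erasures; case: (leqP t s) => [ts | st].
  apply/subset_leq_card/subsetP => l; rewrite !inE coef_vecE !mxE coefB.
  case: (vagr t l ts) => [-> // | vl]; case: (wagr t l ts) => [-> // |].
  by rewrite vl !coef_vecE => -[->]; rewrite subrr eqxx.
rewrite leqn0 cards_eq0; apply/eqP/setP => l.
rewrite !inE coef_vecE !mxE coefB !nth_default ?subrr ?eqxx //.
  exact: leq_trans (ws l) st.
exact: leq_trans (vs l) st.
Qed.

End ErasureDecoding.

Theorem theorem2p6 (F : finFieldType) (n k : nat)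
    (C : {pred 'rV[{poly F}]_n})
    (hC : convolutional_code C k)
    (hdelay : delay_free C k)
    (d : nat -> nat)
    (hd : forall j, is_column_distance C j (d j))
    (s : nat) (v : 'rV[{poly F}]_n)
    (hv : v \in C) (hvs : deg_at_most v s)
    (vhat : nat -> 'rV[option F]_n)
    (hvhat : agrees s vhat v)
    (hwin : forall i, (i <= s)%N ->
      exists j, (\sum_(i <= t < (i + j).+1) erasures s vhat t <= d j - 1)%N) :
  unique (fun w => [/\ w \in C, deg_at_most w s & agrees s vhat w]) v.
Proof.
split=> // w [wC ws wagr]; apply/eqP; rewrite -subr_eq0; apply/eqP.
have eC : v - w \in C.
  by have [[_ lin] _] := hC; rewrite addrC -scaleN1r lin.
have e_wt t := wt_coef_vec_sub_erasures t hvs ws hvhat wagr.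
apply: coef_vec_eq0P => t; elim/ltn_ind: t => i e_lt.
apply/eqP/negPn/negP => e_i.
(* Past [s] no erasure is counted, so a nonzero coefficient cannot occur there; this makes [hwin]
   applicable at [i]. *)
have le_is : (i <= s)%N.
  rewrite leqNgt; apply/negP => lt_si.
  by have := leq_trans (wt_gt0 e_i) (e_wt i); rewrite /erasures [(i <= s)%N]leqNgt lt_si.
have [e' e'C def_e] := delay_free_scaleXn hdelay eC e_lt.
have e'0 : coef_vec e' 0 != 0.
  by rewrite -(coef_vec_scaleXn e' i) -def_e addn0.
have [j win] := hwin i le_is.
have le_d : (truncated_wt e' j <= d j - 1)%N.
  (* The window is shifted to start at 0, to be compared termwise with the weights of [e']. *)
  apply: leq_trans win; rewrite -addnS -{1}[i]add0n big_addn addKn.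
  rewrite /truncated_wt; apply: leq_sum => t _.
  by rewrite -(coef_vec_scaleXn e' i) -def_e addnC.
have := leq_trans ((hd j).2 e' e'C e'0) le_d.
(* Subtraction is truncated, so [d j <= d j - 1] is absurd only for [d j] positive; the positive
   weight of [e'] excludes [d j = 0]. *)
have := leq_trans (truncated_wt_gt0 j e'0) le_d.
by case: (d j) => // m _; rewrite subn1 ltnn.
Qed.
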